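(* Let $X$ be an indecomposable cycle set and let $\pi=\pi(|\mathcal{G}(X)|)$. Consider a twisted extension $\mathrm{pr}: Y = X\otimes_\Phi A\twoheadrightarrow X$ where $\gcd(|\mathcal{G}(X)|,|A_x|)=1$ for all $x\in X$ and where $Y$ is indecomposable. For $x\in X$ put $\Phi_x=\sum_{y\in X}\Phi(x,y)\in A$. Then there is a semidirect product decomposition of braces $$\mathcal{G}(Y)=\mathcal{G}(Y)_\pi\ltimes K,$$ where $\mathcal{G}(Y)_\pi=\{(x,a)\mapsto(\lambda_g(x),g\cdot a): g\in\mathcal{G}(X)\}\cong\mathcal{G}(X)$ and $K=\langle\Phi_x: x\in X\rangle\leq A$ is a trivial brace such that the $\lambda$-action of $\mathcal{G}(Y)_\pi$ on $K$ coincides with the $\mathcal{G}(X)$-module structure on $K$ in the following sense: for $f\in K$, acting on $Y$ by $\lambda_f(x,a)=(x,a+f_x)$, and $g\in\mathcal{G}(X)$, we have $\lambda_{s(g)}(f)=g\cdot f$, where $s:\mathcal{G}(X)\to\mathcal{G}(Y)$ denotes the unique section of $\mathcal{G}(\mathrm{pr}):\mathcal{G}(Y)\twoheadrightarrow\mathcal{G}(X)$ with $s(\mathcal{G}(X))=\mathcal{G}(Y)_\pi$.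
   Context: A cycle set is a finite set $X$ with a binary operation $\ast$ such that $(x\ast y)\ast(x\ast z)=(y\ast x)\ast(y\ast z)$ for all $x,y,z\in X$, each map $\sigma_x: y\mapsto x\ast y$ is bijective, and $x\mapsto x\ast x$ is bijective (all cycle sets are assumed finite and nondegenerate). The permutation group is $\mathcal{G}(X)=\langle \sigma_x : x\in X\rangle\leq \mathrm{Sym}(X)$; put $\lambda_x=\sigma_x^{-1}\in\mathcal{G}(X)$, and for $g\in\mathcal{G}(X)$ write $\lambda_g(x)$ for the image of $x\in X$ under $g$. $X$ is indecomposable if it has no partition into two nonempty sub-cycle sets; equivalently $\mathcal{G}(X)$ acts transitively on $X$. For an integer $n$, $\pi(n)$ is the set of primes dividing $n$. Braces: a brace is $(B,+,\circ)$ with $(B,+)$ an abelian group, $(B,\circ)$ a group and $a\circ(b+c)=a\circ b-a+a\circ c$. Its $\lambda$-action is $\lambda_a(b)=a\circ b-a$, a homomorphism $(B,\circ)\to\mathrm{Aut}(B,+)$. A left ideal is an additive subgroup $I$ with $\lambda_a(I)=I$ for all $a\in B$; it is an ideal if also normal in $(B,\circ)$. A brace is trivial if $a\circ b=a+b$ for all $a,b$. $B$ is a semidirect product $B_2\ltimes B_1$ of left ideals $B_1,B_2$ if $B_1$ is an ideal and $(B,+)=B_1\oplus B_2$. For a finite brace $B$ and a set of primes $\pi$, $B_\pi$ is the set of $a\in B$ whose additive order is divisible only by primes in $\pi$. For a cycle set $X$, $\mathcal{G}(X)$ carries a unique addition making it a brace with $\circ$ the composition of permutations and $\lambda_x+\lambda_y=\lambda_x\circ\lambda_{\lambda_x^{-1}(y)}$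 for $x,y\in X$. A surjective homomorphism $\varphi:Y\to X$ of cycle sets induces a unique brace homomorphism $\mathcal{G}(\varphi):\mathcal{G}(Y)\to\mathcal{G}(X)$ with $\lambda_y\mapsto\lambda_{\varphi(y)}$. The notation $\lambda_g$ is used both for the action of $g\in\mathcal{G}(X)$ on $X$ and for its $\lambda$-action on the brace $\mathcal{G}(X)$. Graded modules and twisted extensions: an $X$-graded $\mathcal{G}(X)$-module is an abelian group $A=\bigoplus_{x\in X}A_x$ with a $\mathcal{G}(X)$-action by automorphisms such that $g\cdot A_x\subseteq A_{\lambda_g(x)}$; $A^{\mathrm{sc}}=\bigsqcup_{x\in X}\{x\}\times A_x$. Given $\Phi:X\times X\to A$ with $\Phi(x,y)\in A_y$ and $\Phi(\lambda_g(x),\lambda_g(y))=g\cdot\Phi(x,y)$ for all $x,y\in X$, $g\in\mathcal{G}(X)$, the twisted extension $X\otimes_\Phi A$ is the cycle set on $A^{\mathrm{sc}}$ with operation $(x,a)\ast(y,b)=(x\ast y,\lambda_x^{-1}\cdot(b+\Phi(x,y)))$, together with $\mathrm{pr}:X\otimes_\Phi A\twoheadrightarrow X$, $(x,a)\mapsto x$. The group $A$ is identified with the subgroup of $\mathrm{Sym}(A^{\mathrm{sc}})$ acting by $f\cdot(x,b)=(x,b+f_x)$ for $f=(f_x)_{x\in X}\in A$. *)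

(* Defs.v *)
From HB Require Import structures.
From mathcomp Require Import all_boot all_order all_algebra all_fingroup.
From mathcomp Require Import all_solvable.

Set Implicit Arguments.
Unset Strict Implicit.
Unset Printing Implicit Defensive.

Import GRing.Theory FinRing.Theory.
Local Open Scope ring_scope.

Reserved Notation "a \circ b" (at level 40, left associativity).

HB.mixin Record isBrace B of GRing.Zmodule B := {
  circ : B -> B -> B;
  cone : B;
  cinv : B -> B;
  circA : associative circ;
  circ1b : left_id cone circ;
  circVb : left_inverse cone cinv circ;
  circDr : forall a b c : B, circ a (b + c) = circ a b - a + circ a c
}.

#[short(type="braceType")]
HB.structure Definition Brace := {B of GRing.Zmodule B & isBrace B}.

#[short(type="finBraceType")]
HB.structure Definition FinBrace := {B of FinRing.Zmodule B & isBrace B}.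

Notation "a \circ b" := (circ a b) : ring_scope.

Definition lact (B : braceType) (a b : B) : B := a \circ b - a.

Definition brace_hom (B C : braceType) (f : B -> C) : Prop :=
  {morph f : a b / a + b} /\ {morph f : a b / a \circ b}.

Record left_ideal (B : finBraceType) (I : {set B}) : Prop := LeftIdeal {
  left_ideal0 : 0 \in I;
  left_idealB : {in I &, forall a b, a - b \in I};
  left_ideal_lact : forall a : B, [set lact a b | b in I] = I
}.

Record circ_normal (B : finBraceType) (I : {set B}) : Prop := CircNormal {
  circ_normal1 : cone \in I;
  circ_normalM : {in I &, forall a b, a \circ b \in I};
  circ_normalV : {in I, forall a, cinv a \in I};
  circ_normalJ : forall a b : B, b \in I -> a \circ b \circ cinv a \in I
}.

Definition ideal (B : finBraceType) (I : {set B}) : Prop :=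
  left_ideal I /\ circ_normal I.

Record semidirect (B : finBraceType) (B2 B1 : {set B}) : Prop := Semidirect {
  semidirect_left : left_ideal B2;
  semidirect_ideal : ideal B1;
  semidirect_sum : forall b : B,
    exists! p : B * B, [/\ p.1 \in B2, p.2 \in B1 & b = p.1 + p.2]
}.

Definition trivial_on (B : finBraceType) (I : {set B}) : Prop :=
  {in I &, forall a b, a \circ b = a + b}.

(* The group structure that finalg puts on a finZmodType is the additive one,
   so #[a] is the additive order. *)
Definition pi_part (pi : nat_pred) (B : finBraceType) : {set B} :=
  [set a : B | pi.-nat #[a : (B : finZmodType)]%g].

Record cycleSet := CycleSet {
  cs_sort :> finType;
  cs_op : cs_sort -> cs_sort -> cs_sort;
  cs_eq : forall x y z : cs_sort,
    cs_op (cs_op x y) (cs_op x z) = cs_op (cs_op y x) (cs_op y z);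
  cs_bij : forall x : cs_sort, bijective (cs_op x);
  cs_sq_bij : bijective (fun x : cs_sort => cs_op x x)
}.

(* For finite X, a subset closed under the operation is a cycle set: the
   restrictions of the bijections are injective, hence bijective. *)
Definition sub_cycle_set (X : cycleSet) (S : {set X}) : Prop :=
  {in S &, forall x y, cs_op x y \in S}.

Definition indecomposable (X : cycleSet) : Prop :=
  ~ exists S : {set X},
      [/\ S != set0, ~: S != set0, sub_cycle_set S & sub_cycle_set (~: S)].

Definition cs_hom (Y X : cycleSet) (phi : Y -> X) : Prop :=
  {morph phi : x y / cs_op x y}.

Definition sigma (X : cycleSet) (x : X) : {perm X} :=
  perm (bij_inj (cs_bij x)).

Definition permgrp (X : cycleSet) : {group {perm X}} :=
  [group of <<[set sigma x | x : X]>>%g].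

Record pbrace (X : cycleSet) := Pbrace {
  gperm :> {perm X};
  _ : gperm \in permgrp X
}.

HB.instance Definition _ (X : cycleSet) := [isSub for @gperm X].
HB.instance Definition _ (X : cycleSet) := [Finite of pbrace X by <:].

Section PermBrace.
Variable X : cycleSet.
Implicit Types (x y : X) (g h : pbrace X) (s t : seq X).

Lemma sigmaE x y : sigma x y = cs_op x y.
Proof. by rewrite permE. Qed.

Lemma mem_sigma x : sigma x \in permgrp X.
Proof. by rewrite mem_gen // imset_f. Qed.

Lemma mem_lam x : (sigma x)^-1%g \in permgrp X.
Proof. by rewrite groupV mem_sigma. Qed.

Definition lam x : pbrace X := Pbrace (mem_lam x).

(* perm's product applies its left factor first, so g after h is h * g. *)
Lemma mem_pcirc g h : (gperm h * gperm g)%g \in permgrp X.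
Proof. by rewrite groupM ?(valP g) ?(valP h). Qed.

Definition pcirc g h : pbrace X := Pbrace (mem_pcirc g h).
Definition pone : pbrace X := Pbrace (group1 (permgrp X)).
Lemma mem_pinv g : (gperm g)^-1%g \in permgrp X.
Proof. by rewrite groupV (valP g). Qed.
Definition pinv g : pbrace X := Pbrace (mem_pinv g).

(* The addition is built as follows: wsum [:: x_1; ...; x_n] is the sum
   of the lam x_i, computed by the rule
     lam x + lam y = lam x \circ lam ((lam x)^-1 y),
   and two elements are added by concatenating words that represent them;
   padd_lam and padd_unique characterize the result. *)
Definition wstep (p : {perm X}) x : {perm X} := (p * sigma (p x))%g.
Definition wperm s : {perm X} := foldl wstep 1%g s.

Lemma foldl_wstep p s :
  foldl wstep p s = (p * wperm (map (fun x => p x) s))%g.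
Proof.
rewrite -[in LHS](mulg1 p) /wperm.
elim: s (1%g : {perm X}) => [|x s IHs] q //=.
by rewrite -IHs /wstep permM mulgA.
Qed.

Lemma wperm_cat s t :
  wperm (s ++ t) = (wperm s * wperm (map (fun x => wperm s x) t))%g.
Proof. by rewrite /wperm foldl_cat foldl_wstep. Qed.

Lemma sigma_swap x y :
  (sigma x * sigma (cs_op x y) = sigma y * sigma (cs_op y x))%g.
Proof. by apply/permP=> z; rewrite !permM !sigmaE cs_eq. Qed.

Lemma wperm_catC s t : wperm (s ++ t) = wperm (t ++ s).
Proof.
have swap2 p x y : wstep (wstep p x) y = wstep (wstep p y) x.
  by rewrite /wstep !permM !sigmaE -!mulgA sigma_swap.
have move1 p x u : foldl wstep p (rcons u x) = foldl wstep p (x :: u).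
  elim: u p => [|y u IHu] p //=.
  by rewrite IHu /= swap2.
rewrite /wperm; elim: s t => [|x s IHs] t; first by rewrite cats0.
rewrite -cat_rcons -IHs.
have <- : foldl wstep 1%g (rcons (s ++ t) x) = foldl wstep 1%g ((x :: s) ++ t).
  by rewrite move1.
by rewrite rcons_cat.
Qed.

Lemma mem_wperm s : wperm s \in permgrp X.
Proof.
rewrite /wperm; elim/last_ind: s => [|s x IHs]; first exact: group1.
by rewrite foldl_rcons groupM ?mem_sigma.
Qed.

Lemma wperm_surj p : p \in permgrp X -> exists s, wperm s = p.
Proof.
case/gen_prodgP=> n [c cP ->].
elim: n c cP => [|n IHn] c cP; first by exists [::]; rewrite big_ord0.
rewrite big_ord_recr /=.
have [|s <-] := IHn (fun i => c (widen_ord (leqnSn n) i)).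
  by move=> i; apply: cP.
have /imsetP[x _ ->] := cP ord_max.
exists (rcons s ((wperm s)^-1%g x)).
by rewrite /wperm foldl_rcons /wstep permKV.
Qed.

Lemma mem_wsum s : (wperm s)^-1%g \in permgrp X.
Proof. by rewrite groupV mem_wperm. Qed.

End PermBrace.

HB.lock Definition wsum (X : cycleSet) (s : seq X) : pbrace X :=
  Pbrace (mem_wsum s).

Section PermBrace.
Variable X : cycleSet.
Implicit Types (x y : X) (g h : pbrace X) (s t : seq X).

Lemma wsumE s : gperm (wsum s) = (wperm s)^-1%g.
Proof. by rewrite wsum.unlock. Qed.

Lemma wsum_eq s t : (wsum s = wsum t) <-> (wperm s = wperm t).
Proof.
split=> [/(congr1 (@gperm X))|E]; first by rewrite !wsumE => /invg_inj.
by apply: val_inj; rewrite [LHS]wsumE [RHS]wsumE E.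
Qed.

Lemma wsum_surj g : exists s, wsum s == g.
Proof.
have [|s Es] := @wperm_surj X (gperm g)^-1%g; first by rewrite groupV (valP g).
by exists s; apply/eqP/val_inj; rewrite [LHS]wsumE Es invgK.
Qed.

End PermBrace.

HB.lock Definition word (X : cycleSet) (g : pbrace X) : seq X :=
  xchoose (wsum_surj g).

HB.lock Definition padd (X : cycleSet) (g h : pbrace X) : pbrace X :=
  wsum (word g ++ word h).
Arguments padd {X}.

Section PermBrace.
Variable X : cycleSet.
Implicit Types (x y : X) (g h : pbrace X) (s t : seq X).

Lemma wordK g : wsum (word g) = g.
Proof. by rewrite word.unlock; apply/eqP/(xchooseP (wsum_surj g)). Qed.

Lemma wsum_cat_eq s s' t t' :
  wsum s = wsum s' -> wsum t = wsum t' -> wsum (s ++ t) = wsum (s' ++ t').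
Proof.
have key u u' v : wsum u = wsum u' -> wsum (u ++ v) = wsum (u' ++ v).
  by move/wsum_eq=> Eu; apply/wsum_eq; rewrite !wperm_cat Eu.
have C u v : wsum (u ++ v) = wsum (v ++ u).
  by apply/wsum_eq/wperm_catC.
by move=> /key Es /key Et; rewrite Es C Et C.
Qed.

Lemma padd_wsum s t : padd (wsum s) (wsum t) = wsum (s ++ t).
Proof. by rewrite padd.unlock; apply: wsum_cat_eq; rewrite wordK. Qed.

Lemma pcirc_wsum g s : pcirc g (wsum s) = padd g (wsum (map g s)).
Proof.
have Eg : (wperm (word g))^-1%g = gperm g by rewrite -wsumE wordK.
rewrite -[in RHS](wordK g) padd_wsum; apply: val_inj.
rewrite [RHS]wsumE /= wsumE wperm_cat invMg !Eg.
congr (_^-1 * _)%g; congr wperm.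
rewrite -map_comp map_id_in // => x _ /=.
by rewrite wsumE permKV.
Qed.

Lemma paddA : associative (@padd X).
Proof.
by move=> g h k; rewrite -[g]wordK -[h]wordK -[k]wordK !padd_wsum catA.
Qed.

Lemma paddC : commutative (@padd X).
Proof.
move=> g h; rewrite -[g]wordK -[h]wordK !padd_wsum.
by apply/wsum_eq/wperm_catC.
Qed.

Lemma wsum_nil : wsum [::] = pone X.
Proof. by apply: val_inj; rewrite [LHS]wsumE invg1. Qed.

Lemma padd0 : left_id (pone X) padd.
Proof. by move=> g; rewrite -[g]wordK -wsum_nil padd_wsum. Qed.

Lemma wsum_map g s t : wsum s = wsum t -> wsum (map g s) = wsum (map g t).
Proof.
have [u Eu] : exists u, wperm u = gperm g by apply: wperm_surj (valP g).
move=> /(wsum_cat_eq (erefl (wsum u)))/wsum_eq.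
by rewrite !wperm_cat Eu => /mulgI E; apply/wsum_eq.
Qed.

Lemma padd_inj g : injective (padd g).
Proof.
move=> h k; rewrite -[h]wordK -[k]wordK.
have E s : wsum s = wsum (map g (map (pinv g) s)).
  by rewrite -map_comp map_id_in // => x _ /=; rewrite permKV.
rewrite (E (word h)) (E (word k)) -!pcirc_wsum.
by move/(congr1 (@gperm X)) => /= /mulIg W; apply/wsum_map/val_inj.
Qed.

End PermBrace.

HB.lock Definition popp (X : cycleSet) (g : pbrace X) : pbrace X :=
  invF (@padd_inj X g) (pone X).
Arguments popp {X}.

Section PermBrace.
Variable X : cycleSet.
Implicit Types (x y : X) (g h : pbrace X) (s t : seq X).

Lemma paddN : left_inverse (pone X) popp padd.
Proof. by move=> g; rewrite paddC popp.unlock f_invF. Qed.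

HB.instance Definition _ :=
  GRing.isZmodule.Build (pbrace X) (@paddA X) (@paddC X) (@padd0 X) paddN.

Lemma pcircA : associative (@pcirc X).
Proof. by move=> g h k; apply: val_inj; rewrite /= mulgA. Qed.

Lemma pcirc1 : left_id (pone X) (@pcirc X).
Proof. by move=> g; apply: val_inj; rewrite /= mulg1. Qed.

Lemma pcircV : left_inverse (pone X) (@pinv X) (@pcirc X).
Proof. by move=> g; apply: val_inj; rewrite /= mulgV. Qed.

Lemma pcircDr g h k : pcirc g (h + k) = pcirc g h - g + pcirc g k.
Proof.
rewrite -[h]wordK -[k]wordK [_ + _]padd_wsum !pcirc_wsum map_cat -padd_wsum.
set a := wsum _; set b := wsum _.
change (g + (a + b) = g + a - g + (g + b)).
by rewrite (addrC g a) addrK addrCA.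
Qed.

HB.instance Definition _ :=
  isBrace.Build (pbrace X) pcircA pcirc1 pcircV pcircDr.

Lemma wsum1 x : wsum [:: x] = lam x.
Proof.
by apply: val_inj; rewrite [LHS]wsumE /wperm /= /wstep mul1g perm1.
Qed.

Lemma wsum_cons x s : wsum (x :: s) = lam x + wsum s.
Proof. by rewrite -wsum1 [RHS]padd_wsum. Qed.

Lemma padd_lam x y :
  lam x + lam y = lam x \circ lam ((lam x : {perm X})^-1%g y).
Proof.
rewrite -!wsum1 [LHS]padd_wsum; apply: val_inj.
rewrite [LHS]wsumE /= !wsumE /wperm /= /wstep.
by rewrite !(mul1g, perm1) invgK invMg.
Qed.

Lemma pbrace_ind (P : pbrace X -> Prop) :
  P 0 -> (forall x g, P g -> P (lam x + g)) -> forall g, P g.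
Proof.
move=> P0 PD g; rewrite -[g]wordK; elim: (word g) => [|x s IHs].
  by rewrite wsum_nil.
by rewrite wsum_cons; apply: PD.
Qed.

End PermBrace.

(* In particular, taking f bijective: the addition of pbrace X is the only one
   which is compatible with composition and satisfies padd_lam. *)
Lemma padd_unique (X : cycleSet) (B : braceType) (f : pbrace X -> B) :
    {morph f : g h / g \circ h} ->
    (forall x y : X, f (lam x) + f (lam y) =
                     f (lam x \circ lam ((lam x : {perm X})^-1%g y))) ->
  {morph f : g h / g + h}.
Proof.
move=> fM fL.
have cone0 : cone = 0 :> B.
  have := circDr (cone : B) 0 0; rewrite !circ1b !addr0 sub0r => /esym/eqP.
  by rewrite oppr_eq0 => /eqP.
have f1 : f (pone X) = 0.
  have := fM (pone X) (pone X); rewrite [_ \circ _]pcirc1.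
  move/(congr1 (circ (cinv (f (pone X))))).
  by rewrite circA circVb circ1b cone0.
have lactD (a b c : B) : lact a (b + c) = lact a b + lact a c.
  by rewrite /lact circDr -!addrA.
have lact0 (a : B) : lact a 0 = 0.
  by apply: (addrI (lact a 0)); rewrite -lactD !addr0.
have fL' x z : lact (f (lam x)) (f (lam (cs_op x z))) = f (lam z).
  rewrite /lact -fM -[in RHS](addKr (f (lam x)) (f (lam z))) fL addrC /= invgK.
  by rewrite sigmaE.
have fS s : f (wsum s) = \sum_(x <- s) f (lam x).
  have [n] := ubnP (size s); elim: n s => // n IHn [|x s] /= ltsn.
    by rewrite wsum_nil big_nil f1.
  have -> : wsum (x :: s) = lam x \circ wsum (map (sigma x) s).
    apply: val_inj; rewrite [LHS]wsumE /= wsumE -cat1s wperm_cat.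
    by rewrite /wperm /= /wstep mul1g perm1 invMg.
  rewrite fM IHn ?size_map // big_map big_cons.
  set S := \sum_(j <- s) _; rewrite -[LHS](subrK (f (lam x))) addrC.
  congr (_ + _); rewrite -/(lact (f (lam x)) S) /S.
  elim: s {IHn ltsn S} => [|z s IHs]; first by rewrite !big_nil lact0.
  by rewrite !big_cons lactD IHs sigmaE fL'.
move=> g h; rewrite -[g]wordK -[h]wordK [_ + _ in LHS]padd_wsum.
by rewrite !fS big_cat.
Qed.

(* The homomorphism of braces induced by a surjective homomorphism of cycle
   sets phi; Gmap_hom, Gmap_lam and Gmap_unique characterize it. *)
Definition Gmap (Y X : cycleSet) (phi : Y -> X) (h : pbrace Y) : pbrace X :=
  wsum (map phi (word h)).

Section Gmap.
Variables (Y X : cycleSet) (phi : Y -> X).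
Hypotheses (phiM : cs_hom phi) (phi_surj : forall x, exists y, phi y = x).

Lemma wperm_map s y : wperm (map phi s) (phi y) = phi (wperm s y).
Proof.
rewrite /wperm; elim/last_ind: s y => [|s z IHs] y; first by rewrite !perm1.
rewrite map_rcons !foldl_rcons /wstep !permM !IHs !sigmaE; exact/esym/phiM.
Qed.

Lemma wsum_map_eq s t : wsum s = wsum t -> wsum (map phi s) = wsum (map phi t).
Proof.
move/wsum_eq=> E; apply/wsum_eq/permP=> x; have [y <-] := phi_surj x.
by rewrite !wperm_map E.
Qed.

Lemma Gmap_wsum s : Gmap phi (wsum s) = wsum (map phi s).
Proof. by apply: wsum_map_eq; rewrite wordK. Qed.

Lemma Gmap_perm (h : pbrace Y) y : Gmap phi h (phi y) = phi (h y).
Proof.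
rewrite -[h]wordK Gmap_wsum; set s := word h; rewrite !wsumE.
by apply: (@perm_inj _ (wperm (map phi s))); rewrite permKV wperm_map permKV.
Qed.

Lemma Gmap_hom : brace_hom (Gmap phi).
Proof.
split=> g h.
  rewrite -[g]wordK -[h]wordK [_ + _ in LHS]padd_wsum !Gmap_wsum map_cat.
  exact/esym/padd_wsum.
apply: val_inj; apply/permP=> x; have [y <-] := phi_surj x.
rewrite Gmap_perm; change (phi ((gperm h * gperm g)%g y) =
  (gperm (Gmap phi h) * gperm (Gmap phi g))%g (phi y)).
by rewrite !permM !Gmap_perm.
Qed.

Lemma Gmap_lam y : Gmap phi (lam y) = lam (phi y).
Proof.
apply: val_inj; apply/permP=> x; have [z <-] := phi_surj x.
rewrite Gmap_perm /=; apply: (@perm_inj _ (sigma (phi y))).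
by rewrite permKV !sigmaE -phiM -sigmaE permKV.
Qed.

Lemma Gmap_unique (f : pbrace Y -> pbrace X) :
  brace_hom f -> (forall y, f (lam y) = lam (phi y)) -> f =1 Gmap phi.
Proof.
move=> [fD _] fL g; have [GD _] := Gmap_hom.
have f0 (k : pbrace Y -> pbrace X) : {morph k : a b / a + b} -> k 0 = 0.
  by move=> kD; apply: (addrI (k 0)); rewrite -kD !addr0.
elim/pbrace_ind: g => [|x g IHg]; first by rewrite !f0.
by rewrite fD GD IHg fL Gmap_lam.
Qed.

End Gmap.

(* Since cycle sets are finite, only finite modules are considered. The
   grading is an internal direct sum, written with the additive group structure
   of a finZmodType. *)
Record gradedModule (X : cycleSet) := GradedModule {
  gm_sort :> finZmodType;
  gm_comp : X -> {group gm_sort};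
  gm_act : pbrace X -> gm_sort -> gm_sort;
  gm_dprod : \big[dprod/1%g]_(x : X) gm_comp x = [set: gm_sort];
  gm_act1 : forall a, gm_act cone a = a;
  gm_actM : forall g h a, gm_act (g \circ h) a = gm_act g (gm_act h a);
  gm_actD : forall g, {morph gm_act g : a b / a + b};
  gm_act_comp : forall g x a, a \in gm_comp x -> gm_act g a \in gm_comp (g x)
}.

Section GradedModule.
Variables (X : cycleSet) (A : gradedModule X).

Lemma gm_decomp (f : A) : exists c : {ffun X -> A},
  [forall x, c x \in gm_comp A x] && (f == \sum_x c x).
Proof.
have [|c [cP -> _]] := mem_bigdprod (gm_dprod A) (_ : f \in [set: A]).
  by rewrite inE.
exists [ffun x => c x]; apply/andP; split.
  by apply/forallP=> x; rewrite ffunE cP.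
by apply/eqP; apply: eq_bigr => x _; rewrite ffunE.
Qed.

Definition gm_proj (f : A) (x : X) : A :=
  xchoose (gm_decomp f) x.

Lemma gm_proj_mem f x : gm_proj f x \in gm_comp A x.
Proof.
by have /andP[/forallP-> _] := xchooseP (gm_decomp f).
Qed.

Lemma gm_proj_sum f : f = \sum_x gm_proj f x.
Proof. by have /andP[_ /eqP] := xchooseP (gm_decomp f). Qed.

Lemma gm_proj_unique (c : X -> A) :
  (forall x, c x \in gm_comp A x) -> gm_proj (\sum_x c x) =1 c.
Proof.
move=> cP x; set f := \sum_x c x.
have [|d [_ _ dU]] := mem_bigdprod (gm_dprod A) (_ : f \in [set: A]).
  by rewrite inE.
rewrite (dU c) // (dU (gm_proj f)) //; first by move=> y _; apply: gm_proj_mem.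
exact: gm_proj_sum.
Qed.

Record Asc := MkAsc {
  asc_val : X * A;
  _ : asc_val.2 \in gm_comp A asc_val.1
}.

HB.instance Definition _ := [isSub for asc_val].
HB.instance Definition _ := [Finite of Asc by <:].

Definition asc_pt (u : Asc) : X := (asc_val u).1.
Definition asc_vec (u : Asc) : A := (asc_val u).2.

Lemma asc_vecP u : asc_vec u \in gm_comp A (asc_pt u).
Proof. exact: (valP u). Qed.

Lemma asc_eq u v : asc_pt u = asc_pt v -> asc_vec u = asc_vec v -> u = v.
Proof.
by move=> E1 E2; apply: val_inj; move: E1 E2;
  rewrite /asc_pt /asc_vec /=; case: (asc_val u) (asc_val v) => ? ? [? ?] /= -> ->.
Qed.

Lemma gm_actK g : cancel (@gm_act X A g) (gm_act (cinv g)).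
Proof. by move=> a; rewrite -gm_actM circVb gm_act1. Qed.

Lemma gm_act_inj g : injective (@gm_act X A g).
Proof. exact: can_inj (gm_actK g). Qed.

Definition graded_fun (g : pbrace X) (u : Asc) : Asc :=
  @MkAsc (g (asc_pt u), gm_act g (asc_vec u)) (gm_act_comp g (asc_vecP u)).

Lemma graded_fun_inj g : injective (graded_fun g).
Proof.
move=> u v [E1 E2]; apply: asc_eq; first exact: perm_inj E1.
exact: gm_act_inj E2.
Qed.

Lemma shift_mem (f : A) u :
  asc_vec u + gm_proj f (asc_pt u) \in gm_comp A (asc_pt u).
Proof. exact: groupM (asc_vecP u) (gm_proj_mem f _). Qed.

Definition shift_fun (f : A) (u : Asc) : Asc :=
  @MkAsc (asc_pt u, asc_vec u + gm_proj f (asc_pt u)) (shift_mem f u).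

Lemma shift_fun_inj f : injective (shift_fun f).
Proof.
move=> u v [E1]; rewrite E1 => /addIr E2; exact: asc_eq.
Qed.

Record twist := Twist {
  tw_fun :> X -> X -> A;
  tw_mem : forall x y, tw_fun x y \in gm_comp A y;
  tw_equiv : forall (g : pbrace X) x y,
    tw_fun (g x) (g y) = gm_act g (tw_fun x y)
}.

Section TwistedExtension.
Variable Phi : twist.

Lemma tw_op_mem u v :
  gm_act (cinv (lam (asc_pt u))) (asc_vec v + Phi (asc_pt u) (asc_pt v))
    \in gm_comp A (cs_op (asc_pt u) (asc_pt v)).
Proof.
rewrite -sigmaE -[sigma _]invgK.
exact: gm_act_comp (groupM (asc_vecP v) (tw_mem Phi _ _)).
Qed.

Definition tw_op (u v : Asc) : Asc :=
  @MkAsc (cs_op (asc_pt u) (asc_pt v),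
          gm_act (cinv (lam (asc_pt u))) (asc_vec v + Phi (asc_pt u) (asc_pt v)))
    (tw_op_mem u v).

Lemma tw_opE u v z : tw_op (tw_op u v) (tw_op u z) = tw_op (tw_op v u) (tw_op v z).
Proof.
have actE x y (a : A) : gm_act (cinv (lam (cs_op x y)))
      (gm_act (cinv (lam x)) a) =
    gm_act (cinv (lam (cs_op y x))) (gm_act (cinv (lam y)) a).
  rewrite -!gm_actM; congr gm_act; apply: val_inj.
  by rewrite /= !invgK sigma_swap.
have twE x y w : Phi (cs_op x y) (cs_op x w) = gm_act (cinv (lam x)) (Phi y w).
  by rewrite -tw_equiv /= invgK !sigmaE.
apply: asc_eq; rewrite /asc_pt /asc_vec /=; first exact: cs_eq.
rewrite -/(asc_pt u) -/(asc_pt v) -/(asc_pt z).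
by rewrite !twE -!gm_actD actE -!addrA (addrC (Phi (asc_pt v) _)).
Qed.

Lemma tw_op_bij u : bijective (tw_op u).
Proof.
apply: injF_bij => v z [/(bij_inj (cs_bij _)) E1 /gm_act_inj].
by rewrite E1 => /addIr E2; apply: asc_eq.
Qed.

Lemma tw_op_sq_bij : bijective (fun u => tw_op u u).
Proof.
apply: injF_bij => u v [/(bij_inj (@cs_sq_bij X)) E1].
by rewrite E1 => /gm_act_inj /addIr E2; apply: asc_eq.
Qed.

Definition twisted_ext : cycleSet := CycleSet tw_opE tw_op_bij tw_op_sq_bij.

Definition tw_pr : twisted_ext -> X := asc_pt.

Lemma tw_pr_hom : cs_hom tw_pr.
Proof. by []. Qed.

Lemma tw_pr_surj x : exists u, tw_pr u = x.
Proof.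
by exists (@MkAsc (x, 0) (group1 (gm_comp A x))).
Qed.

Definition graded_perm (g : pbrace X) : {perm twisted_ext} :=
  perm (@graded_fun_inj g).

Definition shift_perm (f : A) : {perm twisted_ext} := perm (@shift_fun_inj f).

Definition tw_sum (x : X) : A := \sum_(y : X) Phi x y.

End TwistedExtension.

End GradedModule.

(* Main.v *)
Require Import Defs.
From HB Require Import structures.
From mathcomp Require Import all_boot all_order all_algebra all_fingroup.
From mathcomp Require Import all_solvable.

Set Implicit Arguments.
Unset Strict Implicit.
Unset Printing Implicit Defensive.

(* The permutation sigma_(x,a) of Y is the shift by Phi_x followed by the action
   of sigma_x, so every element of G(Y) is uniquely a composite of some g in G(X)
   followed by a shift by some f in A. The map h |-> (f, g) is additive, since
   lam_(x,a) corresponds to (- Phi_x, lam_x) and g . Phi_x = Phi_(g x). Hence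
   (G(Y), +) is isomorphic to the subgroup of A x G(X) generated by the elements
   (- Phi_x, lam_x). As |A| and |G(X)| are coprime, this subgroup is the product
   of its two projections K and G(X). *)

Import GRing.Theory FinRing.Theory.
Local Open Scope ring_scope.

(** * Braces and multiples in coprime torsion *)

Lemma circI (B : braceType) (a : B) : injective (circ a).
Proof. by move=> b c /(congr1 (circ (cinv a))); rewrite !circA circVb !circ1b. Qed.

Lemma lact_inj (B : braceType) (a : B) : injective (lact a).
Proof. by move=> b c /addIr/circI. Qed.

(** Since [lact a] is injective and [I] is finite, the inclusion of the image of [I] in [I] is
    already an equality. *)
Lemma left_ideal_intro (B : finBraceType) (I : {set B}) :
    0 \in I -> {in I &, forall a b, a - b \in I} ->
    (forall a b : B, b \in I -> lact a b \in I) ->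
  left_ideal I.
Proof.
move=> I0 IB IL; split=> // a; apply/eqP.
rewrite eqEcard card_imset ?leqnn ?andbT; last exact: lact_inj.
by apply/subsetP=> _ /imsetP[b bI ->]; apply: IL.
Qed.

Lemma mulrn_card (V : finZmodType) (v : V) : v *+ #|V| = 0.
Proof.
by rewrite -zmodXgE; apply/eqP; rewrite -order_dvdn -cardsT order_dvdG ?inE.
Qed.

(** The Chinese remainder theorem gives [k] congruent to 0 mod [m] and to 1 mod [n]. As [k] is
    chosen before [V], one multiple of an element of G(Y) can kill one coordinate and fix the
    other. *)
Lemma coprime_mulrn_proj (m n : nat) : coprime m n ->
  exists k, (forall (V : zmodType) (v : V), v *+ m = 0 -> v *+ k = 0) /\
            (forall (V : zmodType) (v : V), v *+ n = 0 -> v *+ k = v).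
Proof.
have mulrn_mod (V : zmodType) (v : V) d k : v *+ d = 0 -> v *+ (k %% d) = v *+ k.
  by move=> v0; rewrite {2}(divn_eq k d) mulrnDr mulnC mulrnA v0 mul0rn add0r.
move=> co_mn; exists (chinese m n 0 1); split=> V v v0.
  by rewrite -(mulrn_mod _ _ m) // chinese_modl // mulrn_mod.
by rewrite -(mulrn_mod _ _ n) // chinese_modr // mulrn_mod.
Qed.

(** * Units of the permutation brace *)

Section PermBraceTheory.
Variable X : cycleSet.
Implicit Types g : pbrace X.

Lemma card_pbrace : #|{: pbrace X}| = #|permgrp X|.
Proof. by rewrite card_sub. Qed.

(** The zero of [pbrace X] is by construction the identity permutation, hence also the unit of
    [circ]. *)
Lemma pcirc0g g : 0 \circ g = g.
Proof. exact: circ1b. Qed.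

Lemma pcircg0 g : g \circ 0 = g.
Proof. by apply: val_inj; rewrite /= mul1g. Qed.

Lemma pcircgV g : g \circ cinv g = 0.
Proof. by apply: val_inj; rewrite /= mulVg. Qed.

End PermBraceTheory.

(** * Homogeneous components and the action *)

Section GradedModuleTheory.
Variables (X : cycleSet) (A : gradedModule X).
Implicit Types (x y : X) (g : pbrace X) (f : A).

Lemma gm_projD f1 f2 x : gm_proj (f1 + f2) x = gm_proj f1 x + gm_proj f2 x.
Proof.
rewrite [in LHS](gm_proj_sum f1) [in LHS](gm_proj_sum f2) -big_split /=.
rewrite gm_proj_unique // => y.
exact: groupM (gm_proj_mem f1 y) (gm_proj_mem f2 y).
Qed.

Lemma gm_act0 g : gm_act g (0 : A) = 0.
Proof. by apply: (addrI (gm_act g 0)); rewrite -gm_actD !addr0. Qed.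

Lemma gm_act_sum g (c : X -> A) :
  gm_act g (\sum_x c x) = \sum_x gm_act g (c x).
Proof.
exact: (big_morph _ (gm_actD g) (gm_act0 g)).
Qed.

Lemma sum_perm_shift g (c : X -> A) : \sum_x c (g x) = \sum_x c x.
Proof. by rewrite [RHS](reindex_inj (@perm_inj _ (gperm g))). Qed.

Lemma gm_proj_act g f x : gm_proj (gm_act g f) (g x) = gm_act g (gm_proj f x).
Proof.
have Vg y : pinv g (g y) = y by rewrite /= permK.
have gV y : g (pinv g y) = y by rewrite /= permKV.
(* The expected component of [gm_act g f] at [y]; uniqueness of components then concludes. *)
pose c y := gm_act g (gm_proj f (pinv g y)).
have -> : gm_act g f = \sum_y c y.
  rewrite [in LHS](gm_proj_sum f) gm_act_sum -(sum_perm_shift g c).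
  by apply: eq_bigr => y _; rewrite /c Vg.
rewrite gm_proj_unique ?/c ?Vg // => y.
by rewrite -[in gm_comp A y](gV y); apply: gm_act_comp; apply: gm_proj_mem.
Qed.

Lemma card_gm : (\prod_(x : X) #|gm_comp A x|)%N = #|A|.
Proof. by rewrite (bigdprod_card (G := [set: A]) (gm_dprod A)) cardsT. Qed.

End GradedModuleTheory.

(** * Shifts, graded permutations and the coordinates on G(Y) *)

Section TwistedExtensionTheory.
Variables (X : cycleSet) (A : gradedModule X) (Phi : twist A).
Implicit Types (x y : X) (g : pbrace X) (f : A).
Local Notation Y := (twisted_ext Phi).
Local Notation pr := (@tw_pr X A Phi).
Implicit Types (u : Y) (h k : pbrace Y).

Lemma gm_proj_tw_sum x : gm_proj (tw_sum Phi x) =1 Phi x.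
Proof. by apply: gm_proj_unique => y; apply: tw_mem. Qed.

Lemma gm_act_tw_sum g x : gm_act g (tw_sum Phi x) = tw_sum Phi (g x).
Proof.
rewrite /tw_sum gm_act_sum -(sum_perm_shift g (Phi (g x))).
by apply: eq_bigr => y _; rewrite tw_equiv.
Qed.

Lemma shift_permD f1 f2 :
  shift_perm Phi (f1 + f2) = (shift_perm Phi f1 * shift_perm Phi f2)%g.
Proof.
apply/permP=> u; rewrite permM !permE.
by apply: asc_eq; rewrite // /asc_vec /asc_pt /= gm_projD addrA.
Qed.

Lemma shift_perm0 : shift_perm Phi 0 = 1%g.
Proof. by apply: (mulgI (shift_perm Phi 0)); rewrite -shift_permD addr0 mulg1. Qed.

Lemma graded_permM g1 g2 :
  graded_perm Phi (g1 \circ g2) = (graded_perm Phi g2 * graded_perm Phi g1)%g.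
Proof.
apply/permP=> u; rewrite permM !permE.
apply: asc_eq; rewrite /asc_vec /asc_pt /= ?permM //.
exact: gm_actM.
Qed.

Lemma graded_perm1 : graded_perm Phi cone = 1%g.
Proof.
by apply: (mulgI (graded_perm Phi cone)); rewrite -graded_permM circ1b mulg1.
Qed.

Lemma graded_permV g : graded_perm Phi (cinv g) = (graded_perm Phi g)^-1%g.
Proof.
apply: (mulIg (graded_perm Phi g)).
by rewrite -graded_permM pcircgV graded_perm1 mulVg.
Qed.

Lemma shift_permN f : shift_perm Phi (- f) = (shift_perm Phi f)^-1%g.
Proof.
by apply: (mulIg (shift_perm Phi f)); rewrite -shift_permD addNr shift_perm0 mulVg.
Qed.

(** The commutation rule of the semidirect product of A and G(X); products of permutations apply the
    left factor first. *)
Lemma shift_graded_perm f g :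
  (shift_perm Phi f * graded_perm Phi g =
   graded_perm Phi g * shift_perm Phi (gm_act g f))%g.
Proof.
apply/permP=> u; rewrite !permM !permE.
by apply: asc_eq; rewrite // /asc_vec /asc_pt /= gm_actD gm_proj_act.
Qed.

(** Projecting to X recovers [g]; after cancelling it, the displacement over each point recovers the
    components of [f]. *)
Lemma graded_shift_inj g1 g2 f1 f2 :
  (graded_perm Phi g1 * shift_perm Phi f1 =
   graded_perm Phi g2 * shift_perm Phi f2)%g -> g1 = g2 /\ f1 = f2.
Proof.
move=> E.
have Eg : g1 = g2.
  apply: val_inj; apply/permP=> x.
  have [u <-] := tw_pr_surj Phi x.
  by move/permP/(_ u)/(congr1 pr): E; rewrite !permM !permE.
split=> //; move: E; rewrite Eg => /mulgI/permP E.
rewrite (gm_proj_sum f1) (gm_proj_sum f2); apply: eq_bigr => x _.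
have [u <-] := tw_pr_surj Phi x.
by move/(_ u)/(congr1 (@asc_vec X A)): E; rewrite !permE => /addrI.
Qed.

Lemma sigma_twisted u :
  sigma u = (shift_perm Phi (tw_sum Phi (pr u)) *
             graded_perm Phi (cinv (lam (pr u))))%g.
Proof.
apply/permP=> v; rewrite permM sigmaE !permE.
apply: asc_eq; rewrite /asc_vec /asc_pt /=; first by rewrite invgK sigmaE.
by congr gm_act; rewrite {2}/asc_vec /= gm_proj_tw_sum.
Qed.

(** The sign reflects that [wsum s] is the inverse of [wperm s]. *)
Definition wshift (s : seq Y) : A := - \sum_(u <- s) tw_sum Phi (pr u).

Lemma wperm_twisted (s : seq Y) :
  wperm s = (shift_perm Phi (\sum_(u <- s) tw_sum Phi (pr u)) *
             graded_perm Phi (cinv (wsum (map pr s))))%g.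
Proof.
elim/last_ind: s => [|s u IHs].
  by rewrite /wperm /= big_nil shift_perm0 graded_permV wsum_nil graded_perm1
             invg1 mulg1.
set g := cinv (wsum (map pr s)) in IHs *.
have -> : cinv (wsum (map pr (rcons s u))) =
          cinv (lam (g (pr u))) \circ g :> pbrace X.
  apply: val_inj; rewrite /= !wsumE !invgK map_rcons.
  by rewrite [in LHS]/wperm foldl_rcons.
clearbody g.
rewrite [in LHS]/wperm foldl_rcons -/(wperm s) /wstep sigma_twisted IHs.
have -> : pr ((shift_perm Phi (\sum_(u <- s) tw_sum Phi (pr u)) *
               graded_perm Phi g)%g u) = g (pr u).
  by rewrite permM !permE.
(* The new letter contributes the shift by [tw_sum Phi (g (pr u))], which is [g] applied to
   [tw_sum Phi (pr u)]. Moving it to the left of [graded_perm Phi g] removes the twist by [g], so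
   the shifts simply add up. *)
rewrite -gm_act_tw_sum -cats1 big_cat big_seq1 /= shift_permD graded_permM.
by rewrite -!mulgA; congr mulg; rewrite !mulgA -shift_graded_perm.
Qed.

(* Sends (x, a) |-> (g x, g a + f_(g x)) to f. *)
Definition shift_part h : A := wshift (word h).

Lemma wsum_twisted (s : seq Y) :
  gperm (wsum s) =
    (graded_perm Phi (wsum (map pr s)) * shift_perm Phi (wshift s))%g.
Proof.
by rewrite wsumE wperm_twisted invMg graded_permV invgK shift_permN.
Qed.

Lemma pbrace_twistedE h :
  gperm h =
    (graded_perm Phi (Gmap pr h) * shift_perm Phi (shift_part h))%g.
Proof. by rewrite -[in LHS](wordK h) wsum_twisted. Qed.

Lemma pbrace_twisted_parts h g f :
  gperm h = (graded_perm Phi g * shift_perm Phi f)%g ->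
  Gmap pr h = g /\ shift_part h = f.
Proof. by rewrite pbrace_twistedE => /graded_shift_inj. Qed.

Lemma pbrace_twisted_inj h k :
  Gmap pr h = Gmap pr k -> shift_part h = shift_part k -> h = k.
Proof. by move=> Eg Ef; apply: val_inj; rewrite /= !pbrace_twistedE Eg Ef. Qed.

Lemma shift_part_wsum s : shift_part (wsum s) = wshift s.
Proof. by have [] := pbrace_twisted_parts (wsum_twisted s). Qed.

(** Addition in G(Y) concatenates words, and [wshift] is additive on concatenations. *)
Fact shift_part_morph : nmod_morphism shift_part.
Proof.
split=> [|h k].
  by rewrite -[0](wsum_nil Y) shift_part_wsum /wshift big_nil oppr0.
rewrite -[h]wordK -[k]wordK [_ + _ in LHS]padd_wsum !shift_part_wsum.
by rewrite /wshift big_cat opprD.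
Qed.

HB.instance Definition _ :=
  GRing.isNmodMorphism.Build (pbrace Y) A shift_part shift_part_morph.

Fact Gmap_pr_morph : nmod_morphism (Gmap pr).
Proof.
have [GD _] := Gmap_hom (@tw_pr_hom X A Phi) (tw_pr_surj Phi); split=> //.
by apply: (addrI (Gmap pr 0)); rewrite -GD !addr0.
Qed.

HB.instance Definition _ :=
  GRing.isNmodMorphism.Build (pbrace Y) (pbrace X) (Gmap pr) Gmap_pr_morph.

Lemma Gmap_prM : {morph Gmap pr : h k / h \circ k}.
Proof. by have [] := Gmap_hom (@tw_pr_hom X A Phi) (tw_pr_surj Phi). Qed.

(** With respect to composition the shift coordinate is a 1-cocycle. Subtracting its value at [h]
    leaves the module action, which is how the lambda-action on K gets identified. *)
Lemma shift_partM h k :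
  shift_part (h \circ k) = shift_part h + gm_act (Gmap pr h) (shift_part k).
Proof.
have [|_ ->] // := @pbrace_twisted_parts (h \circ k) (Gmap pr h \circ Gmap pr k)
  (shift_part h + gm_act (Gmap pr h) (shift_part k)).
rewrite /= (pbrace_twistedE h) (pbrace_twistedE k) graded_permM -!mulgA.
by congr mulg; rewrite !mulgA shift_graded_perm -mulgA -shift_permD addrC.
Qed.

Lemma Gmap_pr_lact h k : Gmap pr (lact h k) = lact (Gmap pr h) (Gmap pr k).
Proof. by rewrite /lact raddfB /= Gmap_prM. Qed.

Lemma shift_part_lact h k :
  shift_part (lact h k) = gm_act (Gmap pr h) (shift_part k).
Proof. by rewrite /lact raddfB /= shift_partM addrC addKr. Qed.

(** * Images of the two coordinates *)

Local Notation KA := <<[set tw_sum Phi x | x : X]>>%g.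

Lemma shift_part_mem h : shift_part h \in KA.
Proof.
rewrite /shift_part /wshift -zmodVgE groupV.
elim: (word h) => [|u s IHs]; first by rewrite big_nil; apply: group1.
by rewrite big_cons; apply: groupM IHs; rewrite mem_gen ?imset_f.
Qed.

Lemma shift_part_surj f : f \in KA -> exists h, shift_part h = f.
Proof.
case/gen_prodgP=> n [c cP ->]; elim/big_ind: _ => [|f1 f2 [h1 <-] [h2 <-]|i _].
- by exists 0; rewrite raddf0.
- by exists (h1 + h2); rewrite raddfD.
have /imsetP[x _ ->] := cP i; have [u <-] := tw_pr_surj Phi x.
exists (- wsum [:: u]).
by rewrite raddfN /= shift_part_wsum /wshift big_seq1 opprK.
Qed.

Lemma Gmap_pr_surj g : exists h, Gmap pr h = g.
Proof.
elim/pbrace_ind: g => [|x g [h <-]]; first by exists 0; rewrite raddf0.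
have [u <-] := tw_pr_surj Phi x; exists (lam u + h).
by rewrite raddfD /= (Gmap_lam (@tw_pr_hom X A Phi) (tw_pr_surj Phi)).
Qed.

(** * Splitting G(Y) when the orders are coprime *)

Section Coprime.
Hypothesis coXA : forall x, coprime #|permgrp X| #|gm_comp A x|.

Lemma coprime_pbrace_gm : coprime #|{: pbrace X}| #|A|.
Proof.
rewrite card_pbrace -card_gm.
by apply: (big_ind (coprime _)) => [|m n|x _]; rewrite ?coprimen1 ?coprimeMr //;
  move=> -> ->.
Qed.

Lemma pi_part_twisted h :
  (h \in pi_part \pi(#|permgrp X|) (pbrace Y)) = (shift_part h == 0).
Proof.
rewrite inE -card_pbrace.
have X0 : (0 < #|{: pbrace X}|)%N by apply/card_gt0P; exists 0.
(* If the order of [h] is a pi-number, it is coprime to |A| and kills [shift_part h], which must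
   vanish. Conversely, if the shift vanishes, then |G(X)| times [h] has both coordinates zero, so
   the order of [h] divides |G(X)|. *)
apply/idP/eqP=> [pi_h | h0].
  have co_hA : coprime #[h : (pbrace Y : finZmodType)]%g #|A|.
    apply: pnat_coprime pi_h _; rewrite -coprime_pi' ?coprime_pbrace_gm //.
    by apply/card_gt0P; exists 0.
  have [k [k0 k1]] := coprime_mulrn_proj co_hA.
  rewrite -[LHS](k1 A) ?mulrn_card // k0 // -raddfMn /= -zmodXgE expg_order.
  exact: raddf0.
apply: (@pnat_dvd _ #|{: pbrace X}|); last by rewrite pnat_pi.
rewrite order_dvdn zmodXgE; apply/eqP/pbrace_twisted_inj.
  by rewrite raddfMn /= mulrn_card raddf0.
by rewrite raddfMn /= h0 mul0rn raddf0.
Qed.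

(** Each coordinate is surjective separately onto its image; coprimality makes the pair surjective
    onto the product. *)
Lemma twisted_parts_surj g f :
  f \in KA -> exists h, Gmap pr h = g /\ shift_part h = f.
Proof.
move=> /shift_part_surj[hf Ef]; have [hg Eg] := Gmap_pr_surj g.
have [k [kX kA]] := coprime_mulrn_proj coprime_pbrace_gm.
have := coprime_pbrace_gm; rewrite coprime_sym => /coprime_mulrn_proj[l [lA lX]].
(* The multiple [hf *+ k] has coordinates (0, f), and [hg *+ l] has coordinates (g, 0). *)
exists (hf *+ k + hg *+ l); rewrite !raddfD /= !raddfMn /= Ef Eg.
split; first by rewrite kX ?lX ?mulrn_card ?add0r.
by rewrite kA ?lA ?mulrn_card ?addr0.
Qed.

Lemma graded_perm_mem g : graded_perm Phi g \in permgrp Y.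
Proof.
have [h [Eg Ef]] := twisted_parts_surj g (group1 [group of KA]).
by rewrite -[graded_perm _ _]mulg1 -shift_perm0 -Eg -[0]Ef -pbrace_twistedE (valP h).
Qed.

Definition twisted_section g : pbrace Y := Pbrace (graded_perm_mem g).

Lemma twisted_section_parts g :
  Gmap pr (twisted_section g) = g /\ shift_part (twisted_section g) = 0.
Proof. by apply: pbrace_twisted_parts; rewrite shift_perm0 mulg1. Qed.

Lemma twisted_sectionK : cancel twisted_section (Gmap pr).
Proof. by move=> g; case: (twisted_section_parts g). Qed.

Lemma shift_part_section g : shift_part (twisted_section g) = 0.
Proof. by case: (twisted_section_parts g). Qed.

Lemma shift_part0P h : shift_part h = 0 -> h = twisted_section (Gmap pr h).
Proof.
move=> h0; apply: pbrace_twisted_inj; first by rewrite twisted_sectionK.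
by rewrite shift_part_section.
Qed.

Lemma twisted_section_hom : brace_hom twisted_section.
Proof.
split=> g1 g2; apply/esym.
  rewrite [LHS]shift_part0P; first by rewrite raddfD /= !twisted_sectionK.
  by rewrite raddfD /= !shift_part_section addr0.
by apply: val_inj; rewrite /= graded_permM.
Qed.

Local Notation Ypi := (pi_part \pi(#|permgrp X|) (pbrace Y)).

Lemma imset_twisted_section : [set twisted_section g | g : pbrace X] = Ypi.
Proof.
apply/setP=> h; rewrite pi_part_twisted; apply/imsetP/eqP=> [[g _ ->]|/shift_part0P ->].
  exact: shift_part_section.
by exists (Gmap pr h).
Qed.

(** The two summands are the zero sets of the two additive coordinates, and each is stable under
    [lact] by the formula for that coordinate. The second is moreover the kernel of a brace
    homomorphism, hence an ideal. *)
Lemma semidirect_twisted :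
  semidirect Ypi [set h : pbrace Y | Gmap pr h == 0].
Proof.
split.
- apply: left_ideal_intro => [|h k|h k]; rewrite !pi_part_twisted.
  + by rewrite raddf0.
  + by move=> /eqP h0 /eqP k0; rewrite raddfB /= h0 k0 subr0.
  by move=> /eqP k0; rewrite shift_part_lact k0 gm_act0.
- split.
    apply: left_ideal_intro => [|h k|h k]; rewrite !inE.
    + by rewrite raddf0.
    + by move=> /eqP h0 /eqP k0; rewrite raddfB /= h0 k0 subr0.
    by move=> /eqP k0; rewrite Gmap_pr_lact k0 /lact pcircg0 subrr.
  have Gmap_cone : Gmap pr cone = 0 by apply: raddf0.
  split=> [|h k|h|h k]; rewrite !inE ?Gmap_cone //.
  + by move=> /eqP h0 /eqP k0; rewrite Gmap_prM h0 k0 pcirc0g.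
  + by move=> /eqP h0; rewrite -[Gmap _ _]pcircg0 -h0 -Gmap_prM circVb Gmap_cone h0.
  by move=> /eqP k0; rewrite !Gmap_prM k0 pcircg0 -Gmap_prM pcircgV raddf0.
move=> h; exists (twisted_section (Gmap pr h), h - twisted_section (Gmap pr h)).
split=> [|[h1 h2] []] /=; rewrite pi_part_twisted inE.
  by rewrite shift_part_section raddfB /= twisted_sectionK subrr addrC subrK.
move=> /eqP/shift_part0P E1 /eqP h20 ->.
by rewrite raddfD /= h20 addr0 -E1 addrC addKr.
Qed.

End Coprime.

Lemma Gmap_pr_eq0 h :
  Gmap pr h = 0 <-> gperm h = shift_perm Phi (shift_part h).
Proof.
rewrite pbrace_twistedE -{2}[shift_perm _ _]mul1g -graded_perm1.
by split=> [->//|/graded_shift_inj[]].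
Qed.

Lemma trivial_on_ker_Gmap_pr : trivial_on [set h : pbrace Y | Gmap pr h == 0].
Proof.
move=> h k; rewrite !inE => /eqP h0 /eqP k0; apply: pbrace_twisted_inj.
  by rewrite Gmap_prM raddfD /= h0 k0 pcirc0g addr0.
by rewrite shift_partM raddfD /= h0 gm_act1.
Qed.

End TwistedExtensionTheory.

Theorem theorem3p1 (X : cycleSet) (A : gradedModule X) (Phi : twist A)
    (Y := twisted_ext Phi) (pi := \pi(#|permgrp X|))
    (Ypi := pi_part pi (pbrace Y)) :
  indecomposable X ->
  (forall x : X, coprime #|permgrp X| #|gm_comp A x|) ->
  indecomposable Y ->
  [/\ [set gperm h | h : pbrace Y in Ypi] = [set graded_perm Phi g | g : pbrace X] &
    exists K : {set pbrace Y},
      [/\ [set gperm h | h : pbrace Y in K] =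
            [set shift_perm Phi f | f in <<[set tw_sum Phi x | x : X]>>%g],
          semidirect Ypi K,
          trivial_on K &
          exists s : pbrace X -> pbrace Y,
            [/\ brace_hom s,
                cancel s (Gmap (@tw_pr X A Phi)),
                [set s g | g : pbrace X] = Ypi,
                forall s' : pbrace X -> pbrace Y,
                  cancel s' (Gmap (@tw_pr X A Phi)) ->
                  [set s' g | g : pbrace X] = Ypi -> s' =1 s &
                forall (g : pbrace X) (f : A) (h : pbrace Y),
                  f \in <<[set tw_sum Phi x | x : X]>>%g ->
                  gperm h = shift_perm Phi f ->
                  gperm (lact (s g) h) = shift_perm Phi (gm_act g f)]]].
Proof.
move=> _ coXA _.
have sK := twisted_sectionK Phi coXA; have sE := imset_twisted_section Phi coXA.
split.
  apply/setP=> p; rewrite -/Y /Ypi -sE.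
  apply/imsetP/imsetP=> [[_ /imsetP[g _ ->] ->]|[g _ ->]].
    by exists g.
  by exists (twisted_section Phi coXA g); rewrite ?imset_f.
(* K is taken as the kernel of [Gmap]. Its elements are shifts by elements of the subgroup generated
   by the [tw_sum Phi x]; that all such shifts occur follows by lifting the pair (0, f). *)
exists [set h : pbrace Y | Gmap (@tw_pr X A Phi) h == 0]; split.
- apply/setP=> p; apply/imsetP/imsetP=> [[h]|[f fK ->]].
    rewrite inE => /eqP/Gmap_pr_eq0 Eh ->.
    by exists (shift_part h); first exact: shift_part_mem.
  have [h [h0 Ef]] := twisted_parts_surj coXA 0 fK.
  exists h; first by rewrite inE h0.
  by rewrite -Ef; apply/esym/Gmap_pr_eq0.
- exact: semidirect_twisted.
- exact: trivial_on_ker_Gmap_pr.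
exists (twisted_section Phi coXA); split=> //.
- exact: twisted_section_hom.
(* Any value [s' g] equals the section at some [g'], and applying [Gmap] forces [g'] to be [g]. *)
- move=> s' s'K s'E g.
  have /imsetP[g' _ E] : s' g \in [set twisted_section Phi coXA g | g : pbrace X].
    by rewrite sE -/pi -/Ypi -s'E imset_f.
  by rewrite E; congr twisted_section; rewrite -[LHS]sK -E s'K.
move=> g f h _ Eh.
have [h0 hf] : Gmap (@tw_pr X A Phi) h = 0 /\ shift_part h = f.
  by apply: pbrace_twisted_parts; rewrite graded_perm1 mul1g.
rewrite -hf -[g in RHS]sK -shift_part_lact; apply/Gmap_pr_eq0.
by rewrite Gmap_pr_lact h0 /lact pcircg0 subrr.
Qed.
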